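(* Let $n\ge 4$, let $P$ be an $n\times n$ pentadiagonal matrix over $K$ ($K=\mathbb{R}$ or $\mathbb{C}$) with entries $P_{i,i}=d_i$, $P_{i,i+1}=a_i$, $P_{i,i+2}=b_i$, $P_{i,i-1}=c_i$, $P_{i,i-2}=e_i$ and all other entries $0$, and let $Y=(y_1,\dots,y_n)^t\in K^n$. If the quantities $\mu_1,\dots,\mu_n$ computed by the algorithm PTRANS-I (described in the context) satisfy $\mu_i\neq 0$ for all $i=1,\dots,n$, then PTRANS-I applied to $(P,Y)$ is valid: the vector $X=(x_1,\dots,x_n)^t$ it outputs is the unique solution of $PX=Y$. Moreover, its computational cost (excluding the preliminary determinant check) is $19n-29$ arithmetic operations.
   Context: The algorithm PTRANS-I, on input $n\ge 4$, the entries of $P$, and $Y$, does the following. (0) Check whether $\det(P)=0$; if so, exit. (1) Set $\mu_1=d_1$, $\alpha_1=\frac{a_1}{\mu_1}$, $\beta_1=\frac{b_1}{\mu_1}$, $z_1=\frac{y_1}{\mu_1}$. (2) Set $\gamma_2=c_2$, $\mu_2=d_2-\alpha_1\gamma_2$, $\alpha_2=\frac{a_2-\beta_1\gamma_2}{\mu_2}$, $\beta_2=\frac{b_2}{\mu_2}$, $z_2=\frac{y_2-z_1\gamma_2}{\mu_2}$. (3) For $i=3,\dots,n-2$ in increasing order (no iterations if $n=4$) compute $\gamma_i=c_i-\alpha_{i-2}e_i$, $\mu_i=d_i-\beta_{i-2}e_i-\alpha_{i-1}\gamma_i$, $\alpha_i=\frac{a_i-\beta_{i-1}\gamma_i}{\mu_i}$,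 $\beta_i=\frac{b_i}{\mu_i}$, $z_i=\frac{y_i-z_{i-2}e_i-z_{i-1}\gamma_i}{\mu_i}$. (4) Compute $\gamma_{n-1}=c_{n-1}-\alpha_{n-3}e_{n-1}$, $\mu_{n-1}=d_{n-1}-\beta_{n-3}e_{n-1}-\alpha_{n-2}\gamma_{n-1}$, $\alpha_{n-1}=\frac{a_{n-1}-\beta_{n-2}\gamma_{n-1}}{\mu_{n-1}}$, $\gamma_n=c_n-\alpha_{n-2}e_n$, $\mu_n=d_n-\beta_{n-2}e_n-\alpha_{n-1}\gamma_n$, $z_{n-1}=\frac{y_{n-1}-z_{n-3}e_{n-1}-z_{n-2}\gamma_{n-1}}{\mu_{n-1}}$, $z_n=\frac{y_n-z_{n-2}e_n-z_{n-1}\gamma_n}{\mu_n}$. (5) Set $x_n=z_n$, $x_{n-1}=z_{n-1}-\alpha_{n-1}x_n$, and for $i=n-2,n-3,\dots,1$ set $x_i=z_i-\alpha_ix_{i+1}-\beta_ix_{i+2}$. Output $X=(x_1,\dots,x_n)^t$. The condition ''$\mu_i\ne0$ for all $i$'' means that, computing in order, each $\mu_i$ is nonzero (so every division is defined). The computational cost is the number of additions, subtractions, multiplications and divisions performed when the formulas of steps (1)–(5) are evaluated exactly as written. *)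

(* Defs.v *)
From HB Require Import structures.
From mathcomp Require Import all_boot all_order all_algebra.
From mathcomp Require Import complex reals.

Set Implicit Arguments.
Unset Strict Implicit.
Unset Printing Implicit Defensive.

Import GRing.Theory.

Local Open Scope ring_scope.

Inductive ground_field := RealNumbers | ComplexNumbers.

Definition scalars (R : realType) (k : ground_field) : fieldType :=
  match k with
  | RealNumbers => R
  | ComplexNumbers => R[i]
  end.

(* The ordinals index rows and columns from 0, but only differences matter. *)
Definition pentadiagonal (K : fieldType) (n : nat) (P : 'M[K]_n) : Prop :=
  forall i j : 'I_n, (i + 2 < j)%N || (j + 2 < i)%N -> P i j = 0.

(* PTRANS-I is given as straight-line code over subscripted variables, so that
   its value, its definedness and its operation count all come from the same
   formulas. The inputs are vd, va, vb, vc, ve and vy; subscripts start at 1. *)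
Inductive var :=
  | vd of nat | va of nat | vb of nat | vc of nat | ve of nat | vy of nat
  | valpha of nat | vbeta of nat | vgamma of nat | vmu of nat
  | vz of nat | vx of nat.

Definition var_comparable : comparable var.
Proof. rewrite /comparable /decidable; decide equality; exact: eq_comparable. Defined.

HB.instance Definition _ := comparableMixin var_comparable.

Inductive expr :=
  | Var of var
  | Add of expr & expr
  | Sub of expr & expr
  | Mul of expr & expr
  | Div of expr & expr.

Coercion Var : var >-> expr.

Declare Scope expr_scope.
Delimit Scope expr_scope with E.
Bind Scope expr_scope with expr.
Notation "s + t" := (Add s t) : expr_scope.
Notation "s - t" := (Sub s t) : expr_scope.
Notation "s * t" := (Mul s t) : expr_scope.
Notation "s / t" := (Div s t) : expr_scope.

Fixpoint nops (t : expr) : nat :=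
  match t with
  | Var _ => 0
  | Add s u | Sub s u | Mul s u | Div s u => (nops s + nops u).+1
  end.

Definition assignment := (var * expr)%type.

Definition assign (v : var) (t : expr) : assignment := (v, t).
Arguments assign v t%_E.
Notation "v <~ t" := (assign v t%E) (at level 75, no associativity).

Definition step1 : seq assignment :=
  [:: vmu 1    <~ vd 1;
      valpha 1 <~ va 1 / vmu 1;
      vbeta 1  <~ vb 1 / vmu 1;
      vz 1     <~ vy 1 / vmu 1].

Definition step2 : seq assignment :=
  [:: vgamma 2 <~ vc 2;
      vmu 2    <~ vd 2 - valpha 1 * vgamma 2;
      valpha 2 <~ (va 2 - vbeta 1 * vgamma 2) / vmu 2;
      vbeta 2  <~ vb 2 / vmu 2;
      vz 2     <~ (vy 2 - vz 1 * vgamma 2) / vmu 2].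

Definition step3_at (i : nat) : seq assignment :=
  [:: vgamma i <~ vc i - valpha (i - 2) * ve i;
      vmu i    <~ vd i - vbeta (i - 2) * ve i - valpha (i - 1) * vgamma i;
      valpha i <~ (va i - vbeta (i - 1) * vgamma i) / vmu i;
      vbeta i  <~ vb i / vmu i;
      vz i     <~ (vy i - vz (i - 2) * ve i - vz (i - 1) * vgamma i) / vmu i].

(* i = 3, ..., n - 2 *)
Definition step3 (n : nat) : seq assignment :=
  flatten [seq step3_at i | i <- iota 3 (n - 4)].

Definition step4 (n : nat) : seq assignment :=
  [:: vgamma (n - 1) <~ vc (n - 1) - valpha (n - 3) * ve (n - 1);
      vmu (n - 1)    <~ vd (n - 1) - vbeta (n - 3) * ve (n - 1)
                          - valpha (n - 2) * vgamma (n - 1);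
      valpha (n - 1) <~ (va (n - 1) - vbeta (n - 2) * vgamma (n - 1))
                          / vmu (n - 1);
      vgamma n       <~ vc n - valpha (n - 2) * ve n;
      vmu n          <~ vd n - vbeta (n - 2) * ve n
                          - valpha (n - 1) * vgamma n;
      vz (n - 1)     <~ (vy (n - 1) - vz (n - 3) * ve (n - 1)
                          - vz (n - 2) * vgamma (n - 1)) / vmu (n - 1);
      vz n           <~ (vy n - vz (n - 2) * ve n - vz (n - 1) * vgamma n)
                          / vmu n].

Definition step5_at (i : nat) : assignment :=
  vx i <~ vz i - valpha i * vx (i + 1) - vbeta i * vx (i + 2).

(* The loop runs through i = n - 2, ..., 1 in decreasing order. *)
Definition step5 (n : nat) : seq assignment :=
  [:: vx n       <~ vz n;
      vx (n - 1) <~ vz (n - 1) - valpha (n - 1) * vx n]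
  ++ [seq step5_at i | i <- rev (iota 1 (n - 2))].

Definition steps1_5 (n : nat) : seq assignment :=
  step1 ++ step2 ++ step3 n ++ step4 n ++ step5 n.

Section Semantics.
Variable K : fieldType.

(* None marks a variable without a defined value. *)
Definition store := var -> option K.

Definition update (s : store) (v : var) (w : option K) : store :=
  fun u => if u == v then w else s u.

Definition lift2 (f : K -> K -> option K) (x y : option K) : option K :=
  obind (fun x' => obind (f x') y) x.

(* Division by zero is undefined here, unlike field division where x / 0 = 0,
   and an undefined operand makes the whole expression undefined. *)
Fixpoint eval (s : store) (t : expr) : option K :=
  match t with
  | Var v => s v
  | Add t u => lift2 (fun x y => Some (x + y)) (eval s t) (eval s u)
  | Sub t u => lift2 (fun x y => Some (x - y)) (eval s t) (eval s u)
  | Mul t u => lift2 (fun x y => Some (x * y)) (eval s t) (eval s u)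
  | Div t u => lift2 (fun x y => if y == 0 then None else Some (x / y))
                     (eval s t) (eval s u)
  end.

(* The second component of the state counts the operations performed so far. *)
Definition exec1 (st : store * nat) (q : assignment) : store * nat :=
  (update st.1 q.1 (eval st.1 q.2), st.2 + nops q.2)%N.

Definition exec (st : store * nat) (p : seq assignment) : store * nat :=
  foldl exec1 st p.

Variables (n : nat) (P : 'M[K]_n) (Y : 'cV[K]_n).

(* From a subscript in {1, ..., n} to an ordinal, None outside that range. *)
Definition ord_of_subscript (i : nat) : option 'I_n :=
  if i is i'.+1 then insub i' else None.

Definition entry (i j : nat) : option K :=
  obind (fun k => omap (fun l => P k l) (ord_of_subscript j))
        (ord_of_subscript i).

(* For i <= 1 (resp. i <= 2) the truncated i - 1 (resp. i - 2) is 0, which is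
   not a valid subscript. *)
Definition input_store : store := fun v =>
  match v with
  | vd i => entry i i
  | va i => entry i (i + 1)
  | vb i => entry i (i + 2)
  | vc i => entry i (i - 1)
  | ve i => entry i (i - 2)
  | vy i => omap (fun k => Y k 0) (ord_of_subscript i)
  | _ => None
  end.

Definition final_state : store * nat := exec (input_store, 0%N) (steps1_5 n).

Definition ptrans_mu (i : nat) : option K := final_state.1 (vmu i).

Definition read_x (s : store) : option 'cV[K]_n :=
  if [forall i : 'I_n, isSome (s (vx i.+1))]
  then Some (\col_(i < n) odflt 0 (s (vx i.+1)))
  else None.

(* The output vector together with the number of operations in steps (1)-(5);
   None if the determinant check exits or if some x_i is undefined. *)
Definition PTRANS_I : option ('cV[K]_n * nat) :=
  if \det P == 0 then None
  else omap (fun X => (X, final_state.2)) (read_x final_state.1).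

End Semantics.

(* Main.v *)
(* Ranking the variables so that the assigned ones increase along the program,
   and every read has smaller rank than its target, shows that no variable is
   overwritten or assigned after being read. So the assignments hold as
   equations in the final store. Reading every undefined
   variable as 0 makes these equations uniform in i, boundary indices included.
   They express P = LU with L lower triangular of diagonal mu and U unit upper
   triangular; z solves L z = Y and x solves U x = z. As all mu_i are nonzero,
   P has trivial kernel, hence a nonzero determinant. *)
Require Import Defs.
From mathcomp Require Import all_boot all_order all_algebra.
From mathcomp Require Import complex reals.
From mathcomp Require Import zify ring.

Set Implicit Arguments.
Unset Strict Implicit.
Unset Printing Implicit Defensive.

Import GRing.Theory.

Local Open Scope ring_scope.

(** * Straight-line programs: assignments as equations *)

Fixpoint vars (t : expr) : seq var :=
  match t with
  | Var v => [:: v]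
  | Add s u | Defs.Sub s u | Mul s u | Div s u => vars s ++ vars u
  end.

Section StraightLine.
Variable K : fieldType.
Implicit Types (s : store K) (st : store K * nat) (p : seq assignment).

Lemma eval_eq s s' t :
  (forall u, u \in vars t -> s u = s' u) -> eval s t = eval s' t.
Proof.
elim: t => [v|t IHt u IHu|t IHt u IHu|t IHt u IHu|t IHt u IHu] eqs /=;
  first by apply: eqs; rewrite mem_head.
all: by rewrite IHt ?IHu // => w w_in; apply: eqs; rewrite mem_cat w_in ?orbT.
Qed.

Definition holds s (q : assignment) : Prop := s q.1 = eval s q.2.

(** By recursion, so that on a concrete list of assignments it unfolds to a conjunction that can be
    destructed. *)
Fixpoint all_hold s p : Prop :=
  if p is q :: p' then holds s q /\ all_hold s p' else True.

Lemma all_hold_cat s p1 p2 :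
  all_hold s (p1 ++ p2) <-> all_hold s p1 /\ all_hold s p2.
Proof. by elim: p1 => [|q p1 IH] /=; [tauto | rewrite IH; tauto]. Qed.

Lemma all_hold_flatten s (I : eqType) (f : I -> seq assignment) (r : seq I) i :
  all_hold s (flatten [seq f j | j <- r]) -> i \in r -> all_hold s (f i).
Proof.
elim: r => //= j r IH /all_hold_cat[hj hr].
by rewrite inE => /predU1P[->|/IH]; last exact.
Qed.

Lemma all_hold_map s (I : eqType) (f : I -> assignment) (r : seq I) i :
  all_hold s [seq f j | j <- r] -> i \in r -> holds s (f i).
Proof.
elim: r => //= j r IH [hj hr].
by rewrite inE => /predU1P[->|/IH]; last exact.
Qed.

Lemma exec_nops st p : (exec st p).2 = (st.2 + sumn [seq nops q.2 | q <- p])%N.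
Proof.
by elim: p st => [|q p IH] st /=; [rewrite addn0 | rewrite [LHS]IH addnA].
Qed.

Lemma exec_unassigned st p u :
  all (fun q : assignment => q.1 != u) p -> (exec st p).1 u = st.1 u.
Proof.
elim: p st => //= q p IH st /andP[qu pu].
by rewrite [LHS]IH //= /update eq_sym (negPf qu).
Qed.

Lemma exec_holds (r : var -> nat) st p :
    sorted ltn [seq r q.1 | q <- p] ->
    all (fun q => all (fun u => r u < r q.1)%N (vars q.2)) p ->
  all_hold (exec st p).1 p.
Proof.
elim: p st => //= q p IH st pth /andP[/allP qlt plt].
split; last by apply: IH (path_sorted pth) plt.
(* All later targets rank above [q.1], so [p] changes neither [q.1] nor any variable read by [q]. *)
have fin u : (r u <= r q.1)%N ->
    (exec (exec1 st q) p).1 u = (exec1 st q).1 u.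
  move=> le_u; apply: exec_unassigned.
  have := order_path_min ltn_trans pth; rewrite all_map; apply: sub_all => q' /=.
  by apply: contraTneq => ->; rewrite -leqNgt.
rewrite /holds fin //= /update eqxx; apply: eval_eq => u /qlt lt_u.
rewrite [RHS]fin 1?ltnW //= /update; case: eqVneq lt_u => // ->.
by rewrite ltnn.
Qed.

End StraightLine.

(** * Ranks, targets and operation count of PTRANS-I *)

(* z_(n-1) is computed only after mu_n. *)
Definition rank (n : nat) (v : var) : nat :=
  match v with
  | vgamma i => 6 * i
  | vmu i => 6 * i + 1
  | valpha i => 6 * i + 2
  | vbeta i => 6 * i + 3
  | vz i => if i == (n - 1)%N then 6 * n + 2 else 6 * i + 4
  | vx i => 6 * n + 5 + (n - i)
  | _ => 0
  end%N.

(** Variables outside this range keep their initial value; in particular alpha_0, alpha_n, beta_0,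
    beta_(n-1), beta_n and gamma_1 stay undefined. *)
Definition is_target (n : nat) (v : var) : bool :=
  match v with
  | vmu i | vz i | vx i => 0 < i <= n
  | vgamma i => 1 < i <= n
  | valpha i => 0 < i < n
  | vbeta i => 0 < i <= n - 2
  | _ => false
  end%N.

(** The bound [hi] stands in for the last element of [s1], which is awkward to name when [s1] comes
    from a possibly empty loop. *)
Lemma path_ltn_cat lo hi s1 s2 :
    (lo <= hi)%N -> path ltn lo s1 -> all (leq^~ hi) s1 -> path ltn hi s2 ->
  path ltn lo (s1 ++ s2).
Proof.
elim: s1 lo => [|x s1 IH] lo lohi /=.
  by move=> _ _; case: s2 => //= y s2 /andP[lt ->]; rewrite (leq_ltn_trans lohi).
by move=> /andP[-> pth] /andP[xhi ahi] p2; apply: IH.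
Qed.

Section Ranks.
Local Open Scope nat_scope.
Variables (n : nat) (hn : (4 <= n)%N).
Let ranks (p : seq assignment) := [seq rank n q.1 | q <- p].
Let reads_below (p : seq assignment) :=
  all (fun q => all (fun u => rank n u < rank n q.1)%N (vars q.2)) p.

Ltac rk := rewrite /reads_below /ranks /=; repeat case: eqP => ?;
  repeat (apply/andP; split); lia.

(** Round j uses ranks 6j to 6j + 4, so 6j - 1 separates it from the preceding round. The bound on
    [i + m] keeps the exceptional z_(n-1) out of the loop. *)
Lemma ranks_step3 i m : 0 < i -> (i + m <= n - 1)%N ->
  let p := flatten [seq step3_at j | j <- iota i m] in
  path ltn (6 * i - 1) (ranks p) && all (leq^~ (6 * (i + m) - 1)%N) (ranks p).
Proof.
elim: m i => [//|m IH] i i_gt0 lt_im; cbv zeta; have /andP[IH1 IH2] := IH i.+1 isT ltac:(lia).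
rewrite -[flatten _]/(step3_at i ++ flatten [seq step3_at j | j <- iota i.+1 m]).
rewrite /ranks map_cat all_cat.
have b : all (leq^~ (6 * i + 5)%N) (ranks (step3_at i)) by rk.
apply/and3P; split.
- apply: path_ltn_cat (b) _; [lia | rk |].
  by move: IH1; have -> : (6 * i.+1 - 1 = 6 * i + 5)%N by lia.
- by apply: sub_all b => x; lia.
- by apply: sub_all IH2 => x; lia.
Qed.

(** The starting value is the rank of x_(m+1), computed just before x_m. *)
Lemma ranks_step5 m : (m <= n - 2)%N ->
  path ltn (7 * n - m + 4) (ranks [seq step5_at i | i <- rev (iota 1 m)]).
Proof.
elim: m => // m IH lt_m; have -> : iota 1 m.+1 = rcons (iota 1 m) m.+1.
  by rewrite -[m.+1 in LHS]addn1 iotaD cats1.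
rewrite rev_rcons.
apply/andP; split; first by rewrite /=; lia.
have -> : rank n (vx m.+1) = 7 * n - m + 4 by rewrite /=; lia.
by apply: IH; lia.
Qed.

Lemma ranks_sorted : sorted ltn (ranks (steps1_5 n)).
Proof.
apply: (@path_sorted _ _ 0); rewrite /steps1_5 /step5 /step3 /ranks !map_cat.
have /andP[s3 b3] := @ranks_step3 3 (n - 4) isT ltac:(lia).
(* The successive separators bound the ranks in steps (1) to (4) and in the two assignments of step
   (5) before its loop; the last one, 6n + 6, is the rank of x_(n-1). *)
apply: (@path_ltn_cat _ 11) => //; [rk | rk |].
apply: (@path_ltn_cat _ 17) => //; [rk | rk |].
apply: (@path_ltn_cat _ (6 * (n - 1) - 1)) => //; [lia | |].
  by apply: sub_all b3 => x; lia.
apply: (@path_ltn_cat _ (6 * n + 4)); [lia | rk | rk |].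
apply: (@path_ltn_cat _ (6 * n + 6)); [lia | rk | rk |].
have -> : 6 * n + 6 = 7 * n - (n - 2) + 4 by lia.
exact: ranks_step5.
Qed.

Lemma reads_below_steps : reads_below (steps1_5 n).
Proof.
have all_step3 a r : all a (flatten [seq step3_at i | i <- r]) =
    all (fun i => all a (step3_at i)) r.
  by elim: r => [//|i r IH]; apply: etrans (all_cat _ _ _) _; rewrite IH.
rewrite /reads_below /steps1_5 /step5 /step3 !all_cat all_step3 !all_map all_rev.
apply/and5P; split; [rk | rk | | rk | apply/andP; split; first rk].
- apply/allP => i; rewrite mem_iota => i_in; rewrite /=; rk.
- apply/allP => i; rewrite mem_iota => i_in; rewrite /=; rk.
Qed.

Lemma targets_steps :
  all (fun q : assignment => is_target n q.1) (steps1_5 n).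
Proof.
have step3_all r : all (fun i => 2 < i <= n - 2) r ->
    all (fun q : assignment => is_target n q.1)
        (flatten [seq step3_at i | i <- r]).
  by elim: r => [//|i r IH] /andP[lt_i /IH]; rewrite /= => ->; lia.
have step5_all r : all (fun i => 0 < i <= n - 2) r ->
    all (fun q : assignment => is_target n q.1) [seq step5_at i | i <- r].
  by elim: r => [//|i r IH] /andP[lt_i /IH]; rewrite /= => ->; lia.
rewrite /steps1_5 /step5 !all_cat step3_all ?step5_all.
- by rewrite /=; lia.
- by rewrite all_rev; apply/allP => i; rewrite mem_iota; lia.
- by apply/allP => i; rewrite mem_iota; lia.
Qed.

(** Steps (1), (2), (4) cost 3, 9, 25; each of the n - 4 rounds of step (3) costs 15; x_(n-1) costs
    2 and each of the n - 2 remaining x_i costs 4. *)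
Lemma nops_steps : sumn [seq nops q.2 | q <- steps1_5 n] = (19 * n - 29)%N.
Proof.
have n3 i m : sumn [seq nops q.2 | q <- flatten [seq step3_at j | j <- iota i m]]
    = (15 * m)%N.
  by elim: m i => //= m IH i; rewrite IH; lia.
have n5 r : sumn [seq nops q.2 | q <- [seq step5_at i | i <- r]] = (4 * size r)%N.
  by elim: r => //= i r ->; lia.
rewrite /steps1_5 /step5 /step3 !map_cat !sumn_cat n3 n5 size_rev size_iota /=.
lia.
Qed.

End Ranks.

(** * Pentadiagonal matrices with subscripts from 1 *)

Section Bands.
Variables (K : fieldType) (n : nat) (P : 'M[K]_n).

(* P_(i,j) with subscripts starting at 1, and 0 outside the matrix. *)
Definition coef (i j : nat) : K := odflt 0 (entry P i j).

Definition centry (v : 'cV[K]_n) (i : nat) : K :=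
  odflt 0 (omap (fun k => v k 0) (ord_of_subscript n i)).

Lemma centry_ord v (i : 'I_n) : centry v i.+1 = v i 0.
Proof. by rewrite /centry /= valK. Qed.

Lemma centry_out v i : (n < i)%N -> centry v i = 0.
Proof. by case: i => // i lt_ni; rewrite /centry /= insubN // -leqNgt. Qed.

Lemma entry_ord (i j : 'I_n) : entry P i.+1 j.+1 = Some (P i j).
Proof. by rewrite /entry /= !valK. Qed.

Lemma entry_in i j : (0 < i <= n)%N -> (0 < j <= n)%N ->
  entry P i j = Some (coef i j).
Proof.
case: i j => // i [] // j lt_in lt_jn.
by rewrite /coef; have /= -> := entry_ord (Ordinal lt_in) (Ordinal lt_jn).
Qed.

Lemma coef_col0 i : coef i 0 = 0.
Proof. by rewrite /coef /entry /=; case: (ord_of_subscript n i). Qed.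

Lemma coef_out i j : (n < j)%N -> coef i j = 0.
Proof.
case: j => // j lt_nj; rewrite /coef /entry /= insubN; last by rewrite -leqNgt.
by case: (ord_of_subscript n i).
Qed.

Lemma coef_far (hP : pentadiagonal P) i j :
  (i + 2 < j)%N || (j + 2 < i)%N -> coef i j = 0.
Proof.
case: j => [|j] far; first exact: coef_col0.
case: i far => // i far; rewrite /coef /entry /=.
case: insubP => [l _ lj|_] /=; case: insubP => //= k _ ki.
by rewrite hP // ki lj; lia.
Qed.

(** Boundary rows need no separate formula: [coef] vanishes at column 0, where truncated subtraction
    lands, and at columns beyond n. *)
Lemma mulmx_coef (hP : pentadiagonal P) (v : 'cV[K]_n) (i : 'I_n) :
  let I := i.+1 in let x := centry v in
  (P *m v) i 0 = coef I (I - 2) * x (I - 2)%N + coef I (I - 1) * x (I - 1)%N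
    + coef I I * x I + coef I (I + 1) * x (I + 1)%N + coef I (I + 2) * x (I + 2)%N.
Proof.
move=> I x; pose g j := coef I j * x j.
have g0 : g 0%N = 0 by rewrite /g coef_col0 mul0r.
have -> : (P *m v) i 0 = \sum_(0 <= j < n.+1) g j.
  rewrite mxE big_nat_recl // g0 add0r big_mkord; apply: eq_bigr => j _.
  by rewrite /g /x centry_ord /coef entry_ord.
(* Either bound may be the larger, so both sums are extended by zeros to the common bound
   [n + I + 3]. *)
have -> : \sum_(0 <= j < n.+1) g j = \sum_(0 <= j < I + 3) g j.
  have ext m m' : (m <= m')%N -> (forall j, (m <= j)%N -> g j = 0) ->
      \sum_(0 <= j < m) g j = \sum_(0 <= j < m') g j.
    move=> le_m gz; rewrite [RHS](big_cat_nat (leq0n m) le_m) /= [X in _ + X]big_nat_cond.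
    by rewrite [X in _ + X]big1 ?addr0 // => j; rewrite andbT => /andP[/gz].
  rewrite (@ext n.+1 (n + I + 3)%N); last 2 first.
  - by lia.
  - by move=> j lt_j; rewrite /g coef_out ?mul0r.
  rewrite (@ext (I + 3)%N (n + I + 3)%N) //; first lia.
  by move=> j lt_j; rewrite /g coef_far ?mul0r //; lia.
have gfar j : (I + 2 < j)%N || (j + 2 < I)%N -> g j = 0.
  by move=> far; rewrite /g coef_far ?mul0r.
rewrite -!/(g _); have : (0 < I)%N by [].
(* In rows 1 and 2 some of the five terms are [g 0]; from row 3 on they are the last five of the
   sum, and all earlier ones lie off the band. *)
move: I g g0 gfar => [|[|[|I]]] // g g0 gfar _.
- by rewrite !big_nat_recr // big_nil /= !g0 !add0r.
- by rewrite !big_nat_recr // big_nil /= !g0 !add0r.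
have -> : (I.+3 + 3 = I.+4.+2)%N by lia.
rewrite 5?big_nat_recr //=.
rewrite big_nat_cond big1 ?add0r => [|j].
  by rewrite !subSS !subn0 !addnS !addn0.
by rewrite andbT => lt_j; apply: gfar; lia.
Qed.

End Bands.

(** * The LU factorization and its triangular systems *)

(* The recursions of PTRANS-I say that P = LU, where row i of L holds
   e_i, gamma_i, mu_i and row i of U holds 1, alpha_i, beta_i. *)
Record factorization (K : fieldType) (n : nat) (p : nat -> nat -> K)
    (alpha beta gamma mu : nat -> K) : Prop := Factorization {
  fact_alpha0 : alpha 0 = 0;
  fact_beta0 : beta 0 = 0;
  fact_gamma : forall i, (0 < i <= n)%N ->
    gamma i = p i (i - 1)%N - alpha (i - 2)%N * p i (i - 2)%N;
  fact_mu : forall i, (0 < i <= n)%N ->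
    mu i = p i i - beta (i - 2)%N * p i (i - 2)%N - alpha (i - 1)%N * gamma i;
  fact_alpha : forall i, (0 < i <= n)%N ->
    mu i * alpha i = p i (i + 1)%N - beta (i - 1)%N * gamma i;
  fact_beta : forall i, (0 < i <= n)%N -> mu i * beta i = p i (i + 2)%N }.

Section Factorization.
Variables (K : fieldType) (n : nat) (P : 'M[K]_n) (hP : pentadiagonal P).
Variables (alpha beta gamma mu : nat -> K).
Variable fact : factorization n (coef P) alpha beta gamma mu.

(** Here [w] is Uv, and the conclusion is row [I] of (LU)v = L(Uv). *)
Lemma mulmx_factor (v : 'cV[K]_n) (w : nat -> K) (i : 'I_n) :
    let I := i.+1 in let x := centry v in
    w 0%N = 0 ->
    (forall j, (0 < j <= n)%N ->
      w j = x j + alpha j * x (j + 1)%N + beta j * x (j + 2)%N) ->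
  (P *m v) i 0 = coef P I (I - 2) * w (I - 2)%N + gamma I * w (I - 1)%N
    + mu I * w I.
Proof.
move=> I x w0 wE; rewrite mulmx_coef // -/I -/x.
have lt_I : (0 < I <= n)%N by rewrite /I /=.
have x0 : x 0%N = 0 by [].
(* At subscript 0 the hypothesis on [w] says nothing; there the equation holds because [alpha],
   [beta], [w] and [x] all vanish at 0. *)
have w1 : w (I - 1)%N = x (I - 1)%N + alpha (I - 1)%N * x I
    + beta (I - 1)%N * x (I + 1)%N.
  case: (posnP (I - 1)) => [->|gt0].
    by rewrite w0 x0 (fact_alpha0 fact) (fact_beta0 fact) !mul0r !addr0.
  by rewrite wE; [congr (_ + _ * x _ + _ * x _); lia | lia].
have w2 : w (I - 2)%N = x (I - 2)%N + alpha (I - 2)%N * x (I - 1)%N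
    + beta (I - 2)%N * x I.
  case: (posnP (I - 2)) => [->|gt0].
    by rewrite w0 x0 (fact_alpha0 fact) (fact_beta0 fact) !mul0r !addr0.
  by rewrite wE; [congr (_ + _ * x _ + _ * x _); lia | lia].
rewrite w1 w2 wE // !mulrDr !mulrA (fact_alpha fact) // (fact_beta fact) //.
rewrite (fact_mu fact) // (fact_gamma fact) //; ring.
Qed.

(** The second hypothesis is Lz = y and the third is Uv = z, so [mulmx_factor] applies with [w]
    equal to [z]. *)
Lemma factor_solve (y v : 'cV[K]_n) (z : nat -> K) :
    z 0%N = 0 ->
    (forall i, (0 < i <= n)%N -> mu i * z i = centry y i
      - z (i - 2)%N * coef P i (i - 2) - z (i - 1)%N * gamma i) ->
    (forall i, (0 < i <= n)%N ->
      centry v i = z i - alpha i * centry v (i + 1)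
                  - beta i * centry v (i + 2)) ->
  P *m v = y.
Proof.
move=> z0 zE vE; apply/matrixP => i j; rewrite (ord1 j).
rewrite (mulmx_factor _ z0) => [|k lt_k]; last by rewrite vE //; ring.
by rewrite zE ?centry_ord //=; ring.
Qed.

Hypothesis mu_neq0 : forall i, (0 < i <= n)%N -> mu i != 0.

(** Forward substitution in L, whose diagonal is nonzero, gives Uv = 0; back substitution in the
    unit triangular U then gives v = 0. *)
Lemma factor_ker (v : 'cV[K]_n) : P *m v = 0 -> v = 0.
Proof.
move=> Pv0; set x := centry v.
pose w j := x j + alpha j * x (j + 1)%N + beta j * x (j + 2)%N.
have w0 : w 0%N = 0.
  by rewrite /w (fact_alpha0 fact) (fact_beta0 fact) !mul0r !addr0.
have wz i : (i <= n)%N -> w i = 0.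
  elim/ltn_ind: i => -[//|i] IH lt_i; apply: (mulfI (@mu_neq0 i.+1 lt_i)).
  have := @mulmx_factor v w (Ordinal lt_i) w0 (fun _ _ => erefl).
  rewrite Pv0 mxE /= (IH (i.+1 - 2)%N); [|lia|lia].
  by rewrite (IH (i.+1 - 1)%N) ?mulr0 ?add0r //; lia.
(* Back substitution starts beyond n, where [x] is 0 by convention, and each increment of [m]
   reaches one subscript lower. *)
have xz m j : (n < j + m)%N -> x j = 0.
  elim: m j => [|m IH] j lt_j; first by rewrite /x centry_out // -[j]addn0.
  have [lt_nj|le_jn] := ltnP n j; first exact: centry_out.
  by have := wz _ le_jn; rewrite /w (IH (j + 1)%N) ?(IH (j + 2)%N) ?mulr0 ?addr0 //; lia.
apply/matrixP => i j; rewrite (ord1 j) mxE -centry_ord.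
by apply: (xz n.+1); lia.
Qed.

Lemma factor_det : \det P != 0.
Proof.
(* [det0P] speaks of row vectors in the left kernel, hence the transposition. *)
rewrite -det_tr; apply/det0P => -[v v_neq0 vP].
suff: v^T = 0 by move/(congr1 trmx); rewrite trmxK trmx0; apply/eqP.
by apply: factor_ker; rewrite -[P]trmxK -trmx_mul vP trmx0.
Qed.

End Factorization.

(** * From the final store to the factorization and the solution *)

Section Correctness.
Variables (K : fieldType) (n : nat) (P : 'M[K]_n) (Y : 'cV[K]_n).
Hypotheses (hn : (4 <= n)%N) (hP : pentadiagonal P).
Hypothesis hmu : forall i, (1 <= i <= n)%N ->
  exists2 m : K, ptrans_mu P Y i = Some m & m != 0.

Let s := (final_state P Y).1.
Let val (u : var) : K := odflt 0 (s u).

Let s_all : all_hold s (steps1_5 n).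
Proof. exact: exec_holds (ranks_sorted hn) (reads_below_steps hn). Qed.

Let s_input u : ~~ is_target n u -> s u = input_store P Y u.
Proof.
move=> not_u; apply: exec_unassigned; apply: sub_all (targets_steps hn) => q.
by apply: contraTneq => ->.
Qed.

Let input_d i : (0 < i <= n)%N -> s (vd i) = Some (coef P i i).
Proof. by move=> i_in; rewrite s_input //; apply: entry_in. Qed.

Let input_a i : (0 < i < n)%N -> s (va i) = Some (coef P i (i + 1)).
Proof. by move=> i_in; rewrite s_input //; apply: entry_in; lia. Qed.

Let input_b i : (0 < i <= n - 2)%N -> s (vb i) = Some (coef P i (i + 2)).
Proof. by move=> i_in; rewrite s_input //; apply: entry_in; lia. Qed.

Let input_c i : (1 < i <= n)%N -> s (vc i) = Some (coef P i (i - 1)).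
Proof. by move=> i_in; rewrite s_input //; apply: entry_in; lia. Qed.

Let input_e i : (2 < i <= n)%N -> s (ve i) = Some (coef P i (i - 2)).
Proof. by move=> i_in; rewrite s_input //; apply: entry_in; lia. Qed.

Let input_y i : (0 < i <= n)%N -> s (vy i) = Some (centry Y i).
Proof.
case: i => // i lt_i; rewrite s_input //=.
by rewrite /centry /= insubT.
Qed.

Let mu_def i : (0 < i <= n)%N -> s (vmu i) = Some (val (vmu i)).
Proof. by move=> /hmu[m]; rewrite /ptrans_mu -/s /val => ->. Qed.

Let mu_neq0 i : (0 < i <= n)%N -> val (vmu i) != 0.
Proof. by move=> /hmu[m]; rewrite /ptrans_mu -/s /val => ->. Qed.

Let alpha_out i : (i == 0%N) || (n <= i)%N -> val (valpha i) = 0.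
Proof. by move=> out; rewrite /val s_input //=; lia. Qed.

Let beta_out i : (i == 0%N) || (n - 2 < i)%N -> val (vbeta i) = 0.
Proof. by move=> out; rewrite /val s_input //=; lia. Qed.

Let gamma1 : val (vgamma 1) = 0.
Proof. by rewrite /val s_input. Qed.

Let z0 : val (vz 0) = 0.
Proof. by rewrite /val s_input. Qed.

(* Step (4) computes for i = n - 1 and i = n the same formulas as step (3),
   except for alpha_n, beta_(n-1) and beta_n. *)
Let s_step3 i : (2 < i <= n)%N ->
  [/\ holds s (vgamma i <~ vc i - valpha (i - 2) * ve i),
      holds s (vmu i <~ vd i - vbeta (i - 2) * ve i
                        - valpha (i - 1) * vgamma i)
    & holds s (vz i <~ (vy i - vz (i - 2) * ve i - vz (i - 1) * vgamma i)
                       / vmu i)] /\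
  [/\ (i < n)%N -> holds s
        (valpha i <~ (va i - vbeta (i - 1) * vgamma i) / vmu i)
    & (i <= n - 2)%N -> holds s (vbeta i <~ vb i / vmu i)].
Proof.
move: s_all => /all_hold_cat[_] /all_hold_cat[_] /all_hold_cat[s3].
move=> /all_hold_cat[s4 _] i_in.
have [i_mid|i_end] := leqP i (n - 2).
  have /(all_hold_flatten s3)/= : i \in iota 3 (n - 4) by rewrite mem_iota; lia.
  by case=> hg [hm [ha [hb [hz _]]]].
have [->|->] : i = (n - 1)%N \/ i = n by lia.
  have -> : (n - 1 - 2 = n - 3)%N by lia.
  have -> : (n - 1 - 1 = n - 2)%N by lia.
  by case: s4 => hg [hm [ha [_ [_ [hz _]]]]]; do ![split] => //; lia.
by case: s4 => _ [_ [_ [hg [hm [_ [hz _]]]]]]; do ![split] => //; lia.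
Qed.

Let s_step12 : all_hold s (step1 ++ step2).
Proof.
by move: s_all; rewrite /steps1_5 catA => /all_hold_cat[].
Qed.

Let s_val u w : s u = Some w -> s u = Some (val u).
Proof. by rewrite /val => ->. Qed.

Let val_some u w : s u = Some w -> val u = w.
Proof. by rewrite /val => ->. Qed.

(** Reading None as 0 would hide failures, so definedness is proved together with the values: by
    strong induction all operands are defined, and mu_i being nonzero makes each division succeed.
    The guards mark where a variable is assigned at all. *)
Let s_row i : (0 < i <= n)%N ->
  [/\ (1 < i)%N -> s (vgamma i) = Some (coef P i (i - 1)
        - val (valpha (i - 2)) * coef P i (i - 2)),
      s (vmu i) = Some (coef P i i - val (vbeta (i - 2)) * coef P i (i - 2)
        - val (valpha (i - 1)) * val (vgamma i))
    & s (vz i) = Some ((centry Y i - val (vz (i - 2)) * coef P i (i - 2)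
        - val (vz (i - 1)) * val (vgamma i)) / val (vmu i))] /\
  [/\ (i < n)%N -> s (valpha i) = Some ((coef P i (i + 1)
        - val (vbeta (i - 1)) * val (vgamma i)) / val (vmu i))
    & (i <= n - 2)%N -> s (vbeta i) = Some (coef P i (i + 2) / val (vmu i))].
Proof.
elim/ltn_ind: i => i IH i_in.
have divE (x : K) : (if val (vmu i) == 0 then None else Some (x / val (vmu i)))
    = Some (x / val (vmu i)) by rewrite (negPf (mu_neq0 i_in)).
have mu_i := mu_def i_in; have y_i := input_y i_in; have d_i := input_d i_in.
have alpha_v j : (0 < j < i)%N -> s (valpha j) = Some (val (valpha j)).
  move=> j_in; have [_ [h _]] := IH j ltac:(lia) ltac:(lia).
  by apply: s_val (h _); lia.
have beta_v j : (0 < j < i)%N -> (j <= n - 2)%N -> s (vbeta j) = Some (val (vbeta j)).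
  move=> j_in j_le; have [_ [_ h]] := IH j ltac:(lia) ltac:(lia).
  by apply: s_val (h _).
have z_v j : (0 < j < i)%N -> s (vz j) = Some (val (vz j)).
  move=> j_in; have [[_ _ h] _] := IH j ltac:(lia) ltac:(lia).
  exact: s_val h.
(* In rows 1 and 2 the subscript 0 stands for undefined variables read as 0, so the general formulas
   collapse to steps (1) and (2). *)
have [i_le2|i_gt2] := leqP i 2.
  case: s_step12 => h1 [h2 [h3 [h4 [h5 [h6 [h7 [h8 [h9 _]]]]]]]].
  have [i1|i2] : i = 1%N \/ i = 2%N by lia.
    subst i; rewrite (_ : 1 - 2 = 0)%N // (_ : 1 - 1 = 0)%N // coef_col0.
    rewrite gamma1 alpha_out // beta_out // z0 !mulr0 !subr0.
    split; split=> // *; rewrite ?h1 ?h2 ?h3 ?h4 /=.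
    + by rewrite d_i.
    + by rewrite mu_i y_i /= divE.
    + by rewrite mu_i input_a //= divE.
    + by rewrite mu_i input_b //= divE.
  subst i; have gE : s (vgamma 2) = Some (coef P 2 1) by rewrite h5 /= input_c.
  have g_v := s_val gE.
  rewrite (_ : 2 - 2 = 0)%N // (_ : 2 - 1 = 1)%N // coef_col0 alpha_out // beta_out // z0.
  rewrite !mul0r !subr0.
  split; split=> // *; rewrite ?h6 ?h7 ?h8 ?h9 /=.
  + by rewrite d_i alpha_v // g_v.
  + by rewrite mu_i y_i z_v // g_v /= divE.
  + by rewrite mu_i input_a // beta_v //= ?g_v /= ?divE //; lia.
  + by rewrite mu_i input_b //= divE.
have i_in' : (2 < i <= n)%N by lia.
have [[hg hm hz] [ha hb]] := s_step3 i_in'.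
have gE : s (vgamma i) = Some (coef P i (i - 1)
    - val (valpha (i - 2)) * coef P i (i - 2)).
  by rewrite hg /= input_c ?alpha_v ?input_e //; lia.
have g_v := s_val gE.
split; split=> //.
- by rewrite hm /= d_i g_v beta_v ?alpha_v ?input_e //; lia.
- by rewrite hz /= mu_i y_i g_v !z_v ?input_e //= ?divE //; lia.
- move=> lt_n; rewrite ha //= mu_i g_v beta_v ?input_a /= ?divE //; lia.
- move=> le_n; rewrite hb //= mu_i input_b /= ?divE //; lia.
Qed.

(** The loop formula also covers i = n - 1 and i = n, since alpha_n, beta_(n-1) and beta_n read as
    0. *)
Let s_x i : (0 < i <= n)%N -> s (vx i) = Some
  (val (vz i) - val (valpha i) * val (vx (i + 1)) - val (vbeta i) * val (vx (i + 2))).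
Proof.
have z_v j : (0 < j <= n)%N -> s (vz j) = Some (val (vz j)).
  by move=> /s_row[[_ _ /s_val]].
have [xn xn1 x_mid] : [/\ holds s (vx n <~ vz n),
    holds s (vx (n - 1) <~ vz (n - 1) - valpha (n - 1) * vx n)
    & forall j, (0 < j <= n - 2)%N -> holds s (step5_at j)].
  move: s_all; rewrite /steps1_5 /step5.
  do 4![move=> /all_hold_cat[_]].
  move=> /all_hold_cat[] /= [hn0 [hn1 _]] hx.
  split=> // j j_in; apply: (all_hold_map hx).
  by rewrite mem_rev mem_iota; lia.
have alpha_v j : (0 < j < n)%N -> s (valpha j) = Some (val (valpha j)).
  move=> j_in; have [_ [h _]] := @s_row j ltac:(lia).
  by apply: s_val (h _); lia.
have beta_v j : (0 < j <= n - 2)%N -> s (vbeta j) = Some (val (vbeta j)).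
  move=> j_in; have [_ [_ h]] := @s_row j ltac:(lia).
  by apply: s_val (h _); lia.
(* Each x_i reads later entries only, so the induction is on a bound for [n - i]. *)
move: {2}(n - i)%N (leqnn (n - i)%N) => m.
elim: m i => [|m IH] i le_m i_in.
  have -> : i = n by lia.
  by rewrite xn /= z_v ?alpha_out ?beta_out ?mul0r ?subr0 //; lia.
have x_v j : (i < j <= n)%N -> s (vx j) = Some (val (vx j)).
  by move=> j_in; apply: s_val (IH j _ _); lia.
have [i_le|i_gt] := leqP i (n - 2).
  by rewrite x_mid /= ?z_v ?alpha_v ?beta_v ?x_v //; lia.
have [i_n|i_n1] := eqVneq i n; first by apply: IH; lia.
have -> : i = (n - 1)%N by lia.
rewrite xn1 /= z_v ?alpha_v ?x_v ?[val (vbeta _)]beta_out; try lia.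
by rewrite mul0r subr0 subnK //; lia.
Qed.

Let fact : factorization n (coef P) (fun i => val (valpha i))
  (fun i => val (vbeta i)) (fun i => val (vgamma i)) (fun i => val (vmu i)).
Proof.
split=> [||i i_in|i i_in|i i_in|i i_in] /=; [exact: alpha_out | exact: beta_out | ..].
- have [[h _ _] _] := s_row i_in.
  have [i1|i_gt1] := leqP i 1; last exact: val_some (h _).
  have -> : i = 1%N by lia.
  by rewrite gamma1 coef_col0 mulr0 subr0.
- by have [[_ h _] _] := s_row i_in; apply: val_some h.
- have [_ [h _]] := s_row i_in.
  have [i_lt|i_ge] := ltnP i n.
    by rewrite (val_some (h _)) //= mulrC divfK // mu_neq0.
  (* For i = n both sides vanish: alpha_n and beta_(n-1) read as 0, and column n + 1 is outside the
     matrix. *)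
  rewrite alpha_out ?i_ge ?orbT // coef_out ?beta_out; try lia.
  by rewrite mulr0 mul0r subr0.
- have [_ [_ h]] := s_row i_in.
  have [i_le|i_gt] := leqP i (n - 2).
    by rewrite (val_some (h _)) //= mulrC divfK // mu_neq0.
  by rewrite beta_out ?i_gt ?orbT // coef_out ?mulr0 //; lia.
Qed.

Lemma PTRANS_I_correct : exists X : 'cV[K]_n,
  [/\ PTRANS_I P Y = Some (X, (19 * n - 29)%N),
      P *m X = Y
    & forall X' : 'cV[K]_n, P *m X' = Y -> X' = X].
Proof.
pose X : 'cV[K]_n := \col_i val (vx i.+1).
have XE i : centry X i = val (vx i).
  case: i => [|i]; first by rewrite /val s_input.
  have [lt_in|le_ni] := ltnP i n.
    by rewrite -[i.+1]/(Ordinal lt_in).+1 centry_ord mxE.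
  by rewrite centry_out // /val s_input //= -leqNgt.
have PX : P *m X = Y.
  apply: (factor_solve hP fact (z := fun i => val (vz i)) z0) => i i_in /=.
    have [[_ _ h] _] := s_row i_in.
    by rewrite (val_some h) mulrC divfK // mu_neq0.
  by rewrite !XE; apply: val_some (s_x i_in).
exists X; split=> // [|X' PX'].
  rewrite /PTRANS_I (negPf (factor_det hP fact mu_neq0)) -/s.
  rewrite /final_state exec_nops nops_steps // add0n.
  rewrite /read_x ifT //; apply/forallP => i.
  by rewrite (@s_x i.+1 (ltn_ord i)).
apply/eqP; rewrite -subr_eq0; apply/eqP; apply: (factor_ker hP fact mu_neq0).
by rewrite mulmxBr PX' PX subrr.
Qed.

End Correctness.

Theorem mainTheorem1 (R : realType) (k : ground_field) (n : nat)
    (P : 'M[scalars R k]_n) (Y : 'cV[scalars R k]_n)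
    (hn : (4 <= n)%N) (hP : pentadiagonal P)
    (hmu : forall i : nat, (1 <= i <= n)%N ->
      exists2 m : scalars R k, ptrans_mu P Y i = Some m & m != 0) :
  exists X : 'cV[scalars R k]_n,
    [/\ PTRANS_I P Y = Some (X, (19 * n - 29)%N),
        P *m X = Y
      & forall X' : 'cV[scalars R k]_n, P *m X' = Y -> X' = X].
Proof. exact: PTRANS_I_correct. Qed.
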